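(* Let $T\in\mathcal{BC}^{0,1}(V_3)$. Then for $p,s\in\rho_F(T)$ with $p\notin[s]$ the following equation holds: $$\begin{aligned}&F_3^R(s,T)S_{C,L}^{-1}(p,T)+S_{C,R}^{-1}(s,T)F_3^L(p,T)+\gamma_3^{-1}\Big(sF_3^R(s,T)F_3^L(p,T)p\\&\quad-sF_3^R(s,T)TF_3^L(p,T)-F_3^R(s,T)TF_3^L(p,T)p+F_3^R(s,T)T^2F_3^L(p,T)\Big)\\&=\left[\left(F_3^R(s,T)-F_3^L(p,T)\right)p-\bar s\left(F_3^R(s,T)-F_3^L(p,T)\right)\right](p^2-2s_0p+|s|^2)^{-1}.\end{aligned}$$
   Context: $\mathbb{R}_3$ is the real Clifford algebra generated by $e_1,e_2,e_3$ with $e_ie_j+e_je_i=-2\delta_{ij}$; $(s_0,\dots,s_3)\in\mathbb{R}^4$ is identified with the paravector $s=s_0+\underline{s}$, $\underline{s}=\sum_{j=1}^3s_je_j$; $\bar s=s_0-\underline{s}$, $|s|^2=\sum_{j=0}^3s_j^2$; $[s]=\{s_0+I|\underline{s}|: I\in\mathbb{S}\}$ with $\mathbb{S}=\{\sum_{j=1}^3 e_jx_j:\sum_jx_j^2=1\}$. $V$ is a real Banach space, $V_3=V\otimes\mathbb{R}_3$ with elements $v=\sum_Av_Ae_A$. $\mathcal{B}(V_3)$ is the set of operators $T=\sum_AT_Ae_A$, $T_A$ bounded $\mathbb{R}$-linear on $V$, acting by $T(v)=\sum_{A,B}T_A(v_B)e_Ae_B$. $\mathcal{BC}^{0,1}(V_3)$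 is the set of $T=T_0+\sum_{j=1}^3e_jT_j$ with $T_0,\dots,T_3$ bounded on $V$ and mutually commuting; $\overline{T}=T_0-\sum_{j=1}^3e_jT_j$. Elements of $\mathbb{R}_3$ are regarded as operators on $V_3$ by left multiplication, products are products of operators, $\mathcal{I}$ is the identity. $\sigma_F(T)=\{s\in\mathbb{R}^{4}: s^2\mathcal{I}-s(T+\overline T)+T\overline T\text{ is not invertible}\}$, $\rho_F(T)=\mathbb{R}^{4}\setminus\sigma_F(T)$. For $s\in\rho_F(T)$, with $\mathcal{Q}_s(T)=(s^2\mathcal{I}-s(T+\overline T)+T\overline T)^{-1}$: $F_3^L(s,T)=\gamma_3(s\mathcal{I}-\overline T)\mathcal{Q}_s(T)^{2}$, $F_3^R(s,T)=\gamma_3\mathcal{Q}_s(T)^{2}(s\mathcal{I}-\overline T)$, $S_{C,L}^{-1}(s,T)=(s\mathcal{I}-\overline T)\mathcal{Q}_s(T)$, $S_{C,R}^{-1}(s,T)=\mathcal{Q}_s(T)(s\mathcal{I}-\overline T)$, where $\gamma_3=-4$. *)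

(* Defs.v *)
From HB Require Import structures.
From mathcomp Require Import all_boot all_order all_algebra ring.
From mathcomp Require Import all_classical all_reals all_analysis.

Set Implicit Arguments.
Unset Strict Implicit.
Unset Printing Implicit Defensive.

Import Order.TTheory GRing.Theory Num.Theory.
Import numFieldNormedType.Exports.
Local Open Scope classical_set_scope.
Local Open Scope ring_scope.

(* The blade e_A, A = {i_1 < ... < i_k}, is the product e_{i_1} ... e_{i_k}; the
   generators e_1, e_2, e_3 are indexed by 'I_3.  An element sum_A x_A e_A with
   coefficients in M is the finite function A |-> x_A. *)
Definition blade_idx := {set 'I_3}.

Definition symd (A B : blade_idx) : blade_idx := (A :\: B) :|: (B :\: A).

(* e_A e_B = csign A B * e_(A symd B): there is a factor -1 for each pair
   (i, j) in A x B with j < i (swapping e_i and e_j) and one for each common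
   index (e_i ^ 2 = -1). *)
Definition csign (R : pzRingType) (A B : blade_idx) : R :=
  \prod_(i in A) \prod_(j in B | (j <= i)%N) (-1).

Definition blade (M : nmodType) (A : blade_idx) (x : M) :
  {ffun blade_idx -> M} := [ffun B => if B == A then x else 0].

(* sum_(A, B) f(x_A, y_B) e_A e_B *)
Definition cprod (R : comNzRingType) (M N : Type) (P : lmodType R)
    (f : M -> N -> P) (x : blade_idx -> M) (y : blade_idx -> N) :
    {ffun blade_idx -> P} :=
  \sum_(A : blade_idx) \sum_(B : blade_idx)
    blade (symd A B) (csign R A B *: f (x A) (y B)).

Section CProdTheory.
Variable R : comNzRingType.

Lemma symdE i A B : (i \in symd A B) = (i \in A) (+) (i \in B).
Proof. by rewrite !inE; case: (i \in A); case: (i \in B). Qed.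

Lemma symdA A B C : symd A (symd B C) = symd (symd A B) C.
Proof. by apply/setP => i; rewrite !symdE addbA. Qed.

Lemma symdC A B : symd A B = symd B A.
Proof. by apply/setP => i; rewrite !symdE addbC. Qed.

Lemma symdK A B : symd A (symd A B) = B.
Proof. by apply/setP => i; rewrite !symdE addbA addbb. Qed.

Lemma symd0 A : symd A finset.set0 = A.
Proof. by apply/setP => i; rewrite symdE inE addbF. Qed.

Lemma prod_symd (u : 'I_3 -> R) A B : (forall i, u i * u i = 1) ->
  \prod_(i in symd A B) u i = (\prod_(i in A) u i) * \prod_(i in B) u i.
Proof.
move=> u2; rewrite big_mkcond/= [X in _ = X * _]big_mkcond/=.
rewrite [X in _ = _ * X]big_mkcond/= -big_split/=; apply: eq_bigr => i _.
rewrite symdE; case: (i \in A); case: (i \in B) => /=;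
  by rewrite ?u2 ?mulr1 ?mul1r.
Qed.

Lemma csignDl A B C :
  csign R (symd A B) C = csign R A C * csign R B C.
Proof.
rewrite /csign prod_symd // => i; rewrite -big_split/= big1 // => j _.
by rewrite mulrNN mulr1.
Qed.

Lemma csignDr A B C :
  csign R A (symd B C) = csign R A B * csign R A C.
Proof.
rewrite /csign -big_split/=; apply: eq_bigr => i _.
have E (D : blade_idx) : \prod_(j in D | (j <= i)%N) (-1 : R) =
    \prod_(j in D) (if (j <= i)%N then -1 else 1) by rewrite big_mkcondr.
rewrite !E prod_symd // => j.
by case: ifP; rewrite ?mulrNN mulr1.
Qed.

Lemma csign0l A : csign R finset.set0 A = 1.
Proof. by rewrite /csign big_set0. Qed.

Lemma csign0r A : csign R A finset.set0 = 1.
Proof. by rewrite /csign big1 // => i _; rewrite big1 // => j; rewrite inE. Qed.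

Lemma cprodE (M N : Type) (P : lmodType R) (f : M -> N -> P) x y C :
  cprod f x y C =
  \sum_A csign R A (symd A C) *: f (x A) (y (symd A C)).
Proof.
rewrite /cprod sum_ffunE; apply: eq_bigr => A _; rewrite sum_ffunE.
rewrite (bigD1 (symd A C))//= ffunE symdK eqxx big1 ?addr0// => B neB.
rewrite ffunE; case: eqP => // CE; case/eqP: neB.
by rewrite CE symdK.
Qed.

Lemma linear_sumZ (U W : lmodType R) (g : U -> W) (I : finType)
    (a : I -> R) (u : I -> U) : linear g ->
  g (\sum_i a i *: u i) = \sum_i a i *: g (u i).
Proof.
move=> lg; pose G : {linear U -> W} := HB.pack g (GRing.isLinear.Build _ _ _ _ g lg).
have -> : g = G by [].
by rewrite linear_sum; apply: eq_bigr => i _; rewrite linearZ.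
Qed.

Lemma cprodA (X Y Z : Type) (D E P : lmodType R)
    (f : D -> Z -> P) (g : X -> Y -> D) (h : X -> E -> P) (k : Y -> Z -> E)
    (x : blade_idx -> X) (y : blade_idx -> Y) (z : blade_idx -> Z) :
  (forall c, linear (f ^~ c)) -> (forall A, linear (h (x A))) ->
  (forall A b c, f (g (x A) b) c = h (x A) (k b c)) ->
  cprod f (cprod g x y) z = cprod h x (cprod k y z).
Proof.
move=> lf lh fghk; apply/ffunP => C; rewrite !cprodE.
under eq_bigr => A _.
  rewrite cprodE (@linear_sumZ _ _ (f ^~ _) _ _ _ (lf _)) scaler_sumr.
  over.
rewrite exchange_big/=; apply: eq_bigr => A _.
rewrite cprodE linear_sumZ // scaler_sumr.
rewrite (reindex_inj (h := symd A)); last first.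
  by move=> B B' /(congr1 (symd A)); rewrite !symdK.
apply: eq_bigr => B _; rewrite symdK fghk !scalerA.
have -> : symd (symd A B) C = symd B (symd A C).
  by rewrite symdA (symdC B A).
congr (_ *: _); rewrite csignDl.
set W := symd B _.
have -> : symd A C = symd B W by rewrite /W symdK.
by rewrite csignDr; ring.
Qed.

Lemma blade_eta (M : nmodType) (x : {ffun blade_idx -> M}) :
  x = \sum_A blade A (x A).
Proof.
apply/ffunP => B; rewrite sum_ffunE (bigD1 B)//= ffunE eqxx big1 ?addr0// => A.
by rewrite ffunE eq_sym => /negbTE ->.
Qed.

Lemma cprod_linearr (M : Type) (N P : lmodType R) (f : M -> N -> P)
    (x : blade_idx -> M) : (forall A, linear (f (x A))) ->
  linear (fun y : {ffun blade_idx -> N} => cprod f x y).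
Proof.
move=> lf a y y'; apply/ffunP => C; rewrite !ffunE !cprodE scaler_sumr -big_split/=.
apply: eq_bigr => A _.
by rewrite !ffunE lf scalerDr !scalerA [_ * a]mulrC.
Qed.

Lemma cprod_linearl (N : Type) (M P : lmodType R) (f : M -> N -> P)
    (y : blade_idx -> N) : (forall A, linear (f ^~ (y A))) ->
  linear (fun x : {ffun blade_idx -> M} => cprod f x y).
Proof.
move=> lf a x x'; apply/ffunP => C; rewrite !ffunE !cprodE scaler_sumr -big_split/=.
apply: eq_bigr => A _.
by rewrite !ffunE lf scalerDr !scalerA [_ * a]mulrC.
Qed.

Lemma cprod_blade (M N : zmodType) (P : lmodType R) (f : M -> N -> P) A B a b :
  (forall y, f 0 y = 0) -> (forall x, f x 0 = 0) ->
  cprod f (blade A a) (blade B b) = blade (symd A B) (csign R A B *: f a b).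
Proof.
move=> f0x fx0; apply/ffunP => C; rewrite cprodE (bigD1 A)//= big1 ?addr0.
  rewrite !ffunE eqxx; have -> : (symd A C == B) = (C == symd A B).
    by apply/eqP/eqP => [<-|->]; rewrite symdK.
  by case: eqP => [->|_]; rewrite ?symdK // fx0 scaler0.
by move=> D /negbTE nD; rewrite ffunE nD f0x scaler0.
Qed.

Lemma csign1 (k l : 'I_3) :
  csign R [set k]%SET [set l]%SET = if (l <= k)%N then -1 else 1.
Proof. by rewrite /csign big_set1 big_mkcondr/= big_set1. Qed.

Lemma cprod_bladel (M : zmodType) (N : Type) (P : lmodType R)
    (f : M -> N -> P) (a : M) (y : blade_idx -> N) C :
  (forall b, f 0 b = 0) ->
  cprod f (blade finset.set0 a) y C = f a (y C).
Proof.
move=> f0; rewrite cprodE (bigD1 finset.set0)//= big1 ?addr0; last first.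
  by move=> A /negbTE nA; rewrite ffunE nA f0 scaler0.
by rewrite ffunE eqxx csign0l scale1r symdC symd0.
Qed.

Lemma cprod_blader (M : Type) (N : zmodType) (P : lmodType R)
    (f : M -> N -> P) (b : N) (x : blade_idx -> M) C :
  (forall A, f (x A) 0 = 0) ->
  cprod f x (blade finset.set0 b) C = f (x C) b.
Proof.
move=> f0; rewrite cprodE (bigD1 C)//= big1 ?addr0; last first.
  move=> A AC; rewrite ffunE; case: eqP => [E|]; last by rewrite f0 scaler0.
  by case/eqP: AC; rewrite -[A]symd0 -E symdK.
have -> : symd C C = finset.set0 by apply/setP => i; rewrite symdE inE addbb.
by rewrite ffunE eqxx csign0r scale1r.
Qed.

End CProdTheory.

(* A type of its own, since the ring structure of finite functions is the
   pointwise one. *)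
Definition clifford3 (R : comNzRingType) : Type := {ffun blade_idx -> R^o}.

Section Clifford3.
Variable R : comNzRingType.

HB.instance Definition _ := GRing.Lmodule.copy (clifford3 R)
  {ffun blade_idx -> R^o}.

Definition cl_mul (x y : clifford3 R) : clifford3 R :=
  cprod (P := R^o) *%R x y.

Definition cl_one : clifford3 R := blade (M := R^o) finset.set0 1.

Definition cl_gen (j : 'I_3) : clifford3 R := blade (M := R^o) [set j]%SET 1.

Fact cl_mulA : associative cl_mul.
Proof.
move=> x y z; apply/esym; apply: (@cprodA _ _ _ _ R^o R^o R^o) => [c|A|*].
- by move=> a u v; rewrite mulrDl -scalerAl.
- by move=> a u v; rewrite mulrDr; congr (_ + _); exact: mulrCA.
- by rewrite mulrA.
Qed.

Fact cl_mul1x : left_id cl_one cl_mul.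
Proof.
by move=> x; apply/ffunP => C; rewrite [LHS]cprod_bladel ?mul1r// => b;
  rewrite mul0r.
Qed.

Fact cl_mulx1 : right_id cl_one cl_mul.
Proof.
by move=> x; apply/ffunP => C; rewrite [LHS]cprod_blader ?mulr1// => b;
  rewrite mulr0.
Qed.

Fact cl_mulDl : left_distributive cl_mul +%R.
Proof.
move=> x y z; have := @cprod_linearl R R R^o R^o *%R z _ 1 x y.
by rewrite !scale1r; apply => A a u v; rewrite mulrDl -scalerAl.
Qed.

Fact cl_mulDr : right_distributive cl_mul +%R.
Proof.
move=> z x y; have := @cprod_linearr R R R^o R^o *%R z _ 1 x y.
by rewrite !scale1r; apply => A a u v; rewrite mulrDr; congr (_ + _); exact: mulrCA.
Qed.

Fact cl_one_neq0 : cl_one != 0.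
Proof.
apply/eqP => /ffunP/(_ finset.set0).
by rewrite !ffunE eqxx => /eqP; rewrite oner_eq0.
Qed.

HB.instance Definition _ := GRing.Zmodule_isNzRing.Build (clifford3 R)
  cl_mulA cl_mul1x cl_mulx1 cl_mulDl cl_mulDr cl_one_neq0.

Fact cl_scaleAl (a : R) (x y : clifford3 R) : a *: (x * y) = (a *: x) * y.
Proof.
apply/ffunP => C; rewrite ffunE !cprodE scaler_sumr.
apply: eq_bigr => A _; rewrite ffunE.
by rewrite /GRing.scale/= -mulrA mulrCA.
Qed.

HB.instance Definition _ := GRing.Lmodule_isLalgebra.Build R (clifford3 R)
  cl_scaleAl.

Fact cl_scaleAr (a : R) (x y : clifford3 R) : a *: (x * y) = x * (a *: y).
Proof.
apply/ffunP => C; rewrite ffunE !cprodE scaler_sumr.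
apply: eq_bigr => A _; rewrite ffunE.
by rewrite /GRing.scale/= mulrCA [x A * (a * _)]mulrCA.
Qed.

HB.instance Definition _ := GRing.Lalgebra_isAlgebra.Build R (clifford3 R)
  cl_scaleAr.

Lemma cl_mulE (x y : clifford3 R) :
  x * y = cprod (P := R^o) *%R x y :> {ffun blade_idx -> R^o}.
Proof. by []. Qed.

Lemma cl_gen_anticomm (i j : 'I_3) :
  cl_gen i * cl_gen j + cl_gen j * cl_gen i =
  (- 2 * (i == j)%:R)%:A :> clifford3 R.
Proof.
have genM k l : cl_gen k * cl_gen l =
    blade (M := R^o) (symd [set k]%SET [set l]%SET) (if (l <= k)%N then -1 else 1).
  have := @cprod_blade R R^o R^o R^o *%R [set k]%SET [set l]%SET 1 1.
  move=> /(_ (@mul0r R) (@mulr0 R)) => E; rewrite [LHS]E.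
  by rewrite csign1 /GRing.scale/= !mulr1.
rewrite !genM; have [->|neq_ij] := eqVneq i j.
  rewrite leqnn; have -> : symd [set j]%SET [set j]%SET = finset.set0.
    by apply/setP => k; rewrite symdE addbb finset.in_set0.
  apply/ffunP => C; rewrite !ffunE; case: eqP => _.
    by rewrite mulr1 -opprD /GRing.scale/= mulr1.
  by rewrite addr0 /GRing.scale/= mulr0.
rewrite mulr0 scale0r [X in _ + X]/blade symdC.
apply/ffunP => C; rewrite !ffunE; case: eqP => _; last by rewrite addr0.
have := neq_ij; rewrite -val_eqE /=; case: ltngtP => // _ _.
  by rewrite addNr.
by rewrite addrN.
Qed.

End Clifford3.

Definition invertible (A : pzRingType) (x : A) : Prop :=
  exists y : A, y * x = 1 /\ x * y = 1.

(* The two-sided inverse of x; it is 0 if x is not invertible. *)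
Definition inverse (A : pzRingType) (x : A) : A :=
  xget 0 [set y : A | y * x = 1 /\ x * y = 1].

Section Paravector.
Variable R : realType.

Definition sc (s : 'rV[R]_4) : R := s 0 0.

Definition vec (s : 'rV[R]_4) : 'rV[R]_3 := \row_j s 0 (lift 0 j).

Definition vecC (x : 'rV[R]_3) : clifford3 R := \sum_(j < 3) x 0 j *: cl_gen R j.

Definition para (s : 'rV[R]_4) : clifford3 R := (sc s)%:A + vecC (vec s).

Definition pconj (s : 'rV[R]_4) : clifford3 R := (sc s)%:A - vecC (vec s).

Definition normsq (s : 'rV[R]_4) : R := \sum_(j < 4) s 0 j ^+ 2.

Definition vnorm (x : 'rV[R]_3) : R := Num.sqrt (\sum_(j < 3) x 0 j ^+ 2).

Definition unit_sphere : set (clifford3 R) :=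
  [set vecC x | x in [set x : 'rV[R]_3 | \sum_(j < 3) x 0 j ^+ 2 = 1]].

Definition sphere_class (s : 'rV[R]_4) : set (clifford3 R) :=
  [set (sc s)%:A + vnorm (vec s) *: I | I in unit_sphere].

End Paravector.

Definition bounded_linear (R : realType) (V : normedModType R) (f : V -> V) :=
  linear f /\ exists M : R, forall v, `|f v| <= M * `|v|.

(* T(v) = sum_(A, B) T_A(v_B) e_A e_B *)
Definition opact (R : realType) (V : normedModType R)
    (T : blade_idx -> V -> V) (v : {ffun blade_idx -> V}) :
    {ffun blade_idx -> V} := cprod (fun (f : V -> V) (x : V) => f x) T v.

Definition is_op3 (R : realType) (V : normedModType R) :
    pred ({ffun blade_idx -> V} -> {ffun blade_idx -> V}) :=
  fun F => `[< exists T : blade_idx -> V -> V,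
    (forall A, bounded_linear (T A)) /\ F = opact T >].

(* The set B(V_3), with the composition of operators as product. *)
Record op3 (R : realType) (V : normedModType R) := Op3 {
  op3_fun :> {ffun blade_idx -> V} -> {ffun blade_idx -> V} ;
  op3P : is_op3 op3_fun }.

Section BoundedLinear.
Variables (R : realType) (V : normedModType R).
Implicit Types f g : V -> V.

Lemma bounded_linear0 : bounded_linear (0 : V -> V).
Proof.
split; first by move=> a u v; rewrite /= scaler0 addr0.
by exists 0 => v; rewrite normr0 mul0r.
Qed.

Lemma bounded_linear_id : bounded_linear (@id V).
Proof. by split=> //; exists 1 => v; rewrite mul1r. Qed.

Lemma bounded_linearP a f g : bounded_linear f -> bounded_linear g ->
  bounded_linear (a *: f + g).
Proof.
move=> [lf [M fM]] [lg [N gN]]; split.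
  move=> b u v; rewrite !fctE lf lg !scalerDr !scalerA (mulrC a b).
  by rewrite addrACA.
exists (`|a| * M + N) => v; rewrite !fctE mulrDl.
apply: (le_trans (ler_normD _ _)); apply: lerD => //.
by rewrite normrZ -mulrA ler_wpM2l.
Qed.

Lemma bounded_linearZ a f : bounded_linear f -> bounded_linear (a *: f).
Proof.
by move=> bf; have := bounded_linearP a bf bounded_linear0; rewrite addr0.
Qed.

Lemma bounded_linear_sum (I : Type) (r : seq I) (F : I -> V -> V) :
  (forall i, bounded_linear (F i)) -> bounded_linear (\sum_(i <- r) F i).
Proof.
move=> bF; elim/big_ind: _ => // [|f g bf bg]; first exact: bounded_linear0.
by have := bounded_linearP 1 bf bg; rewrite scale1r.
Qed.

Lemma bounded_linear_comp f g : bounded_linear f -> bounded_linear g ->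
  bounded_linear (f \o g).
Proof.
move=> [lf [M fM]] [lg [N gN]]; split; first by move=> a u v /=; rewrite lg lf.
exists (`|M| * N) => v /=; apply: (le_trans (fM _)).
apply: (@le_trans _ _ (`|M| * `|g v|)); first by rewrite ler_wpM2r ?ler_norm.
by rewrite -mulrA ler_wpM2l.
Qed.

End BoundedLinear.

Section Op3Theory.
Variables (R : realType) (V : normedModType R).
Implicit Types (T U : blade_idx -> V -> V) (F G : op3 V).

Local Notation V3 := {ffun blade_idx -> V}.

HB.instance Definition _ := [isSub of op3 V for @op3_fun R V].
HB.instance Definition _ := [Choice of op3 V by <:].

Lemma is_op3_opact T : (forall A, bounded_linear (T A)) -> is_op3 (opact T).
Proof. by move=> bT; apply/asboolP; exists T. Qed.

Fact is_op3_submod : submod_closed (@is_op3 R V).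
Proof.
split=> [|a F G /asboolP[T [bT ->]] /asboolP[U [bU ->]]].
  apply/asboolP; exists (fun=> 0); split=> [A|]; first exact: bounded_linear0.
  apply/funext => v; apply/ffunP => C; rewrite /opact cprodE big1 ?ffunE// => A _.
  by rewrite scaler0.
apply/asboolP; exists (fun A => a *: T A + U A); split=> [A|].
  exact: bounded_linearP.
apply/funext => v; apply/ffunP => C.
rewrite !fctE !ffunE /opact !cprodE scaler_sumr -big_split/=.
apply: eq_bigr => A _.
by rewrite !fctE scalerDr !scalerA [_ * a]mulrC.
Qed.

HB.instance Definition _ := GRing.isSubmodClosed.Build R (V3 -> V3)
  (@is_op3 R V) is_op3_submod.
HB.instance Definition _ := [SubChoice_isSubLmodule of op3 V by <:].

Lemma op3_linear F : linear F.
Proof.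
case: F => F /= /asboolP[T [bT ->]].
by apply: cprod_linearr => A; have [] := bT A.
Qed.

Fact is_op3_id : is_op3 (@id V3).
Proof.
apply/asboolP; exists (blade (M := V -> V) finset.set0 id); split.
  move=> A; rewrite ffunE; case: eqP => _; first exact: bounded_linear_id.
  exact: bounded_linear0.
by apply/funext => v; apply/ffunP => C; rewrite /opact cprod_bladel.
Qed.

Fact is_op3_comp F G : is_op3 (F \o G).
Proof.
case: F G => F /= /asboolP[T [bT ->]] [G /= /asboolP[U [bU ->]]].
apply/asboolP; exists (cprod (P := V -> V) (fun f g : V -> V => f \o g) T U).
split=> [A|]; last first.
  apply/funext => v; rewrite /opact /=; apply/esym; apply: cprodA => //.
  by move=> A; have [] := bT A.
rewrite cprodE; apply: bounded_linear_sum => B.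
by apply: bounded_linearZ; exact: bounded_linear_comp.
Qed.

Definition op3_id : op3 V := Op3 is_op3_id.
Definition op3_comp F G : op3 V := Op3 (is_op3_comp F G).

Fact op3_compA : associative op3_comp.
Proof. by move=> F G H; apply/val_inj. Qed.

Fact op3_comp1f : left_id op3_id op3_comp.
Proof. by move=> F; apply/val_inj. Qed.

Fact op3_compf1 : right_id op3_id op3_comp.
Proof. by move=> F; apply/val_inj. Qed.

Fact op3_compDl : left_distributive op3_comp +%R.
Proof. by move=> F G H; apply/val_inj. Qed.

Fact op3_compDr : right_distributive op3_comp +%R.
Proof.
move=> F G H; apply/val_inj/funext => v /=.
by have := op3_linear F 1 (G v) (H v); rewrite !scale1r.
Qed.

HB.instance Definition _ := GRing.Zmodule_isPzRing.Build (op3 V)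
  op3_compA op3_comp1f op3_compf1 op3_compDl op3_compDr.

Lemma op3_mulE F G v : (F * G) v = F (G v).
Proof. by []. Qed.

Lemma op3_oneE v : (1 : op3 V) v = v.
Proof. by []. Qed.

Lemma op3_addE F G v : (F + G) v = F v + G v.
Proof. by []. Qed.

Lemma op3_scaleE (a : R) F v : (a *: F) v = a *: F v.
Proof. by []. Qed.

Definition op3_of T (bT : forall A, bounded_linear (T A)) : op3 V :=
  Op3 (is_op3_opact bT).

Lemma op3_scaleAl (a : R) F G : a *: (F * G) = (a *: F) * G.
Proof. by apply/val_inj. Qed.

Lemma op3_scaleAr (a : R) F G : a *: (F * G) = F * (a *: G).
Proof.
apply/val_inj/funext => v /=.
have F0 : F 0 = 0.
  by apply: (addrI (F 0)); rewrite addr0 -{1}[F 0]scale1r -op3_linear scale1r addr0.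
by have := op3_linear F a (G v) 0; rewrite !addr0 F0 addr0.
Qed.

Lemma op3_ofE T (bT : forall A, bounded_linear (T A)) v C :
  op3_of bT v C = \sum_A csign R A (symd A C) *: T A (v (symd A C)).
Proof. by rewrite /= /opact cprodE. Qed.

Definition lmul_coef (x : clifford3 R) A : V -> V := x A *: (@id V).

Fact lmul_coef_bounded x A : bounded_linear (lmul_coef x A).
Proof. by apply: bounded_linearZ; exact: bounded_linear_id. Qed.

Definition lmul (x : clifford3 R) : op3 V := op3_of (lmul_coef_bounded x).

(* A bounded operator on V acting on the coefficients of the elements of V_3,
   i.e. the operator f e_A with A the empty set. *)
Definition const_coef (f : V -> V) : blade_idx -> V -> V :=
  blade (M := V -> V) finset.set0 f.

Fact const_coef_bounded (f : V -> V) (bf : bounded_linear f) A :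
  bounded_linear (const_coef f A).
Proof.
by rewrite /const_coef ffunE; case: eqP => _ //; exact: bounded_linear0.
Qed.

Definition op3_const f (bf : bounded_linear f) : op3 V :=
  op3_of (const_coef_bounded bf).

Lemma op3_constE f (bf : bounded_linear f) v C : op3_const bf v C = f (v C).
Proof. by rewrite /= /opact cprod_bladel. Qed.

Lemma lmul1 : lmul 1 = 1.
Proof.
apply/val_inj/funext => v; apply/ffunP => C; rewrite op3_ofE/=.
rewrite (bigD1 finset.set0)//= big1 ?addr0.
  by rewrite csign0l scale1r /lmul_coef ffunE eqxx !fctE scale1r symdC symd0.
by move=> A /negbTE nA; rewrite /lmul_coef ffunE nA scale0r scaler0.
Qed.

Lemma lmulM x y : lmul (x * y) = lmul x * lmul y.
Proof.
apply/val_inj/funext => v /=; rewrite /opact.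
pose s (a : R^o) (w : V) := a *: w.
have E (z : clifford3 R) (w : V3) : cprod (fun f x : _ => f x) (lmul_coef z) w =
  cprod s z w by [].
rewrite !E; apply: cprodA => [c|A|A b c].
- by move=> a u w; rewrite /s scalerDl -scalerA.
- by move=> a u w; rewrite /s scalerDr !scalerA mulrC.
- by rewrite /s scalerA.
Qed.

Lemma lmulP a x y : lmul (a *: x + y) = a *: lmul x + lmul y.
Proof.
apply/val_inj/funext => v; apply/ffunP => C.
rewrite /= !fctE !ffunE /opact !cprodE scaler_sumr -big_split/=.
apply: eq_bigr => A _; rewrite /lmul_coef !fctE !ffunE scalerDl scalerDr.
by rewrite !scalerA; congr (_ *: _ + _); rewrite /GRing.scale/=; ring.
Qed.

End Op3Theory.

(* The set BC^{0,1}(V_3): the family (T_0, ..., T_3) stands for the operator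
   T_0 + e_1 T_1 + e_2 T_2 + e_3 T_3, see bc_op; it is determined by it, see
   bc_op_inj. *)
Record BC01 (R : realType) (V : normedModType R) := MkBC01 {
  bc_coef : 'I_4 -> V -> V ;
  bc_bounded : forall i, bounded_linear (bc_coef i) ;
  bc_comm : forall i j, bc_coef i \o bc_coef j = bc_coef j \o bc_coef i }.

Section FFunctionalCalculus.
Variables (R : realType) (V : normedModType R).
Implicit Types (T : BC01 V) (s : 'rV[R]_4).

Definition bc_comp T i : op3 V := op3_const (bc_bounded T i).

Definition bc_vec T : op3 V :=
  \sum_(j < 3) lmul V (cl_gen R j) * bc_comp T (lift 0 j).

Definition bc_op T : op3 V := bc_comp T 0 + bc_vec T.

Definition bc_conj T : op3 V := bc_comp T 0 - bc_vec T.

Lemma bc_op_blade T v C : bc_op T (blade finset.set0 v) C =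
  (C == finset.set0)%:R *: bc_coef T 0 v +
  \sum_(j < 3) (C == [set j]%SET)%:R *: bc_coef T (lift 0 j) v.
Proof.
have bc0 i : bc_coef T i 0 = 0.
  have [lT _] := bc_bounded T i.
  apply: (addrI (bc_coef T i 0)).
  by rewrite addr0 -{1}[bc_coef T i 0]scale1r -lT scale1r addr0.
have bcE i : bc_comp T i (blade finset.set0 v) =
    blade finset.set0 (bc_coef T i v).
  by apply/ffunP => D; rewrite op3_constE !ffunE; case: eqP.
have sumE (I : finType) (F : I -> op3 V) (w : {ffun blade_idx -> V}) :
    (\sum_i F i) w C = \sum_i F i w C.
  elim/big_ind2 : _ => [|F1 a F2 b E1 E2|//]; first by rewrite ffunE.
  by rewrite ffunE E1 E2.
rewrite [LHS]ffunE sumE; congr (_ + _).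
  rewrite -[LHS]/(bc_comp T 0 (blade finset.set0 v) C) bcE ffunE.
  by case: eqP => _; rewrite ?scale1r ?scale0r.
apply: eq_bigr => j _.
rewrite -[LHS]/(opact (lmul_coef (V := V) (cl_gen R j))
  (bc_comp T (lift 0 j) (blade finset.set0 v)) C) bcE.
rewrite /opact cprod_blader; last first.
  by move=> A; rewrite /lmul_coef !fctE scaler0.
by rewrite /lmul_coef !fctE ffunE; case: eqP => _; rewrite ?scale1r ?scale0r.
Qed.

Lemma bc_op_inj T U : bc_op T = bc_op U -> bc_coef T = bc_coef U.
Proof.
move=> TU; apply/funext => i; apply/funext => v.
have E C : bc_op T (blade finset.set0 v) C = bc_op U (blade finset.set0 v) C.
  by rewrite TU.
have neq0 (j : 'I_3) : (finset.set0 == [set j]%SET) = false.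
  by apply/eqP => /setP/(_ j); rewrite finset.in_set0 finset.set11.
case: (unliftP 0 i) => [j|] ->.
  have := E [set j]%SET; rewrite !bc_op_blade eq_sym neq0 !scale0r !add0r.
  have sumE (W : BC01 V) :
      \sum_(k < 3) ([set j]%SET == [set k]%SET)%:R *: bc_coef W (lift 0 k) v =
      bc_coef W (lift 0 j) v.
    rewrite (bigD1 j)//= eqxx scale1r big1 ?addr0// => k kj.
    case: eqP => [/setP/(_ k)|_]; last by rewrite scale0r.
    by rewrite finset.in_set1 finset.set11 (negbTE kj).
  by rewrite !sumE.
have := E finset.set0; rewrite !bc_op_blade eqxx !scale1r.
by rewrite !big1 ?addr0// => j _; rewrite neq0 scale0r.
Qed.

Definition Qinv s T : op3 V :=
  lmul V (para s) ^+ 2 - lmul V (para s) * (bc_op T + bc_conj T)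
  + bc_op T * bc_conj T.

Definition sigma_F T : set 'rV[R]_4 := [set s | ~ invertible (Qinv s T)].

Definition rho_F T : set 'rV[R]_4 := ~` sigma_F T.

Definition Q s T : op3 V := inverse (Qinv s T).

Definition gamma3 : R := - 4.

Definition F3L s T : op3 V :=
  gamma3 *: ((lmul V (para s) - bc_conj T) * Q s T ^+ 2).

Definition F3R s T : op3 V :=
  gamma3 *: (Q s T ^+ 2 * (lmul V (para s) - bc_conj T)).

Definition SCL s T : op3 V := (lmul V (para s) - bc_conj T) * Q s T.

Definition SCR s T : op3 V := Q s T * (lmul V (para s) - bc_conj T).

End FFunctionalCalculus.

(* Main.v *)
From HB Require Import structures.
Require Import Defs.
From mathcomp Require Import all_boot all_order all_algebra ring lra.
From mathcomp Require Import all_classical all_reals all_analysis.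
Import Order.TTheory GRing.Theory Num.Theory.
Import numFieldNormedType.Exports.
Local Open Scope classical_set_scope.
Local Open Scope ring_scope.

(** The identity is algebra in a ring, once a few commutation rules between
    T and the paravectors are known.  Let s' be the Clifford conjugate of s,
    let X and Y be F_R(s, T) and F_L(p, T) without the factor gamma, and let T'
    be the conjugate of T.

    The rules are that T commutes with T', and that T + T' and T T' act on each
    coefficient separately, so that they commute with every paravector although
    T does not (bc_trace, bc_norm): the imaginary part of T squares to minus the
    sum of the T_j ^ 2, because the e_j anticommute and the T_j commute.  Hence
    Q_s commutes with s, and (s - T') acts as an adjugate of the pencil:
    s (s - T') = (s - T') T + Q_s^-1, which gives s X - X T = Q_s, and on the
    other side Y p - T Y = Q_p (fR_rel, fL_rel).

    The bracket of the equation is then (s X - X T) (Y p - T Y) = Q_s Q_p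
    (bracket_factor), and the left-hand side is gamma times
      L = X (p - T') Q_p + Q_s (s - T') Y + Q_s Q_p.
    Moving s and p inwards with the same relations yields L p - s L = X - Y
    (L_rel).  As s + s' = 2 s_0 and s' s = |s| ^ 2 are real,
      L (p ^ 2 - 2 s_0 p + |s| ^ 2) = (L p - s L) p - s' (L p - s L),
    which is (X - Y) p - s' (X - Y) (ring_resolvent).

    Finally p ^ 2 - 2 s_0 p + |s| ^ 2 is itself a paravector, by the quadratic
    equation of p; it is therefore invertible unless it vanishes, and it
    vanishes only for p in [s] (para_poly, para_poly_invertible). *)

(** * Generalities on rings *)

Lemma inverseP (A : pzRingType) (x : A) : invertible x ->
  inverse x * x = 1 /\ x * inverse x = 1.
Proof.
move=> [y xy].
exact: (@xgetPex _ 0 [set y | y * x = 1 /\ x * y = 1] (ex_intro _ y xy)).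
Qed.

Lemma comm_inverse {A : pzRingType} {x y z : A} : y * x = 1 -> x * y = 1 ->
  GRing.comm z x -> GRing.comm z y.
Proof.
move=> yx xy zx; rewrite /GRing.comm -[LHS]mul1r -yx -(mulrA y) (mulrA x) -zx.
by rewrite -(mulrA z) xy mulr1.
Qed.

(** The mixed products cancel in pairs.  This serves both for the vector part of
    a paravector and for the vector part of the operator T. *)
Lemma sqr_sum_anticomm (A : pzRingType) n (x : 'I_n -> A) :
  (forall i j, i != j -> x i * x j = - (x j * x i)) ->
  (\sum_i x i) ^+ 2 = \sum_i x i ^+ 2.
Proof.
elim: n x => [|n IHn] x xN; first by rewrite !big_ord0 expr0n.
rewrite !big_ord_recl -IHn => [|i j ij]; last by rewrite xN ?(inj_eq lift_inj).
set y := \sum_(i < n) _; have xy : x ord0 * y = - (y * x ord0).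
  rewrite mulr_sumr mulr_suml -sumrN; apply: eq_bigr => i _.
  by rewrite xN ?neq_lift.
by rewrite !expr2 mulrDl !mulrDr xy addrA subrK.
Qed.

Lemma sqrB_scalar (K : comNzRingType) (A : algType K) (a : K) (v : A) :
  (a%:A + v) * (a%:A - v) = (a ^+ 2)%:A - v ^+ 2.
Proof.
rewrite mulrDl !mulrBr -!scalerAl !mul1r -scalerAr mulr1 scalerA -!expr2.
by rewrite addrA subrK.
Qed.

(** * The resolvent equation in an abstract ring *)

(** The elements t and t' stand for T and its conjugate, qs and qp for the
    inverses Q_s(T) and Q_p(T); s and p need not commute with t. *)
Section RingResolvent.
Variables (A : pzRingType) (s p t t' qs qp : A).
Hypotheses (tt' : GRing.comm t t').
Hypotheses (s_tr : GRing.comm s (t + t')) (p_tr : GRing.comm p (t + t')).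
Hypotheses (s_nm : GRing.comm s (t * t')) (p_nm : GRing.comm p (t * t')).
Local Notation pencil x := (x ^+ 2 - x * (t + t') + t * t').
Hypotheses (qsP : qs * pencil s = 1) (Pqs : pencil s * qs = 1).
Hypotheses (qpP : qp * pencil p = 1) (Pqp : pencil p * qp = 1).

(* The F-resolvents without the factor gamma. *)
Let fR := qs ^+ 2 * (s - t').
Let fL := (p - t') * qp ^+ 2.
Let L := fR * ((p - t') * qp) + qs * (s - t') * fL + qs * qp.

Lemma comm_pencil x : GRing.comm x (t + t') -> GRing.comm x (t * t') ->
  GRing.comm x (pencil x).
Proof.
move=> xtr xnm; apply: commrD => //; apply: commrB; first exact: commrX.
exact: commrM.
Qed.

Lemma comm_s_qs : GRing.comm s qs.
Proof. exact: (comm_inverse qsP Pqs (comm_pencil _ s_tr s_nm)). Qed.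

Lemma comm_p_qp : GRing.comm p qp.
Proof. exact: (comm_inverse qpP Pqp (comm_pencil _ p_tr p_nm)). Qed.

(** The difference of the two products is s ^ 2 - s t' - s t + t' t, in which s
    always comes first: this is the pencil as soon as t and t' commute. *)
Lemma pencil_left : s * (s - t') = (s - t') * t + pencil s.
Proof.
rewrite mulrBl -tt' [_ + t * t']addrC subrKA addrCA mulrBr mulrDr opprD.
by rewrite addNKr expr2.
Qed.

(** The mirror image of pencil_left.  The pencil has p on the left of t + t', so
    p has to be moved across t + t'. *)
Lemma pencil_right : (p - t') * p = t * (p - t') + pencil p.
Proof.
rewrite mulrBr [_ + t * t']addrC subrKA addrCA p_tr mulrBl mulrDl opprD.
by rewrite addNKr expr2.
Qed.

Lemma fR_rel : s * fR = fR * t + qs.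
Proof.
rewrite /fR mulrA (commrX 2 comm_s_qs) expr2 -!mulrA pencil_left.
by rewrite mulrDr qsP mulrDr mulr1.
Qed.

Lemma fL_rel : fL * p = t * fL + qp.
Proof.
rewrite /fL -mulrA -(commrX 2 comm_p_qp) mulrA pencil_right mulrDl.
by rewrite expr2 !mulrA Pqp mul1r.
Qed.

(** On the left, p meets (p - t') qp and fL; on the right, s meets fR and
    qs (s - t').  Each time it is replaced by t up to a remainder: the terms
    in t agree on both sides, the pencils leave fR and fL, and what remains is
    qs (u + p) qp = qs (w + s) qp with u = s - t' and w = p - t'. *)
Lemma L_rel : L * p + fL = fR + s * L.
Proof.
have E1 x : x * ((p - t') * qp) * p = x + x * t * ((p - t') * qp).
  rewrite -!mulrA -comm_p_qp (mulrA (p - t')) pencil_right (mulrDl _ _ qp) Pqp.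
  by rewrite mulrDr mulr1 addrC !mulrA.
have E2 x : s * (qs * (s - t') * x) = qs * (s - t') * t * x + x.
  rewrite !mulrA comm_s_qs -(mulrA qs) pencil_left (mulrDr qs) qsP mulrDl mul1r.
  by rewrite !mulrA.
have E3 : qs * (s - t') * qp + qs * qp * p = qs * ((p - t') * qp) + s * (qs * qp).
  rewrite [s * _]mulrA comm_s_qs -!mulrA -comm_p_qp -!mulrDr -!mulrDl.
  by congr (_ * (_ * _)); rewrite addrAC [RHS]addrAC [p + s]addrC.
have F1 x : s * (fR * x) = fR * t * x + qs * x by rewrite mulrA fR_rel mulrDl.
have F2 x : x * fL * p = x * t * fL + x * qp.
  by rewrite -mulrA fL_rel mulrDr mulrA.
rewrite /L !(mulrDl _ _ p) !(mulrDr s) E1 E2 F1 F2.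
rewrite -!addrA; congr (_ + (_ + _)); rewrite [RHS]addrCA; congr (_ + _).
by rewrite [RHS]addrCA -E3 addrA [LHS]addrC.
Qed.

(** The four terms are the expansion of (s fR - fR t) (fL p - t fL). *)
Lemma bracket_factor :
  s * fR * fL * p - s * fR * t * fL - fR * t * fL * p + fR * t ^+ 2 * fL =
  qs * qp.
Proof.
have -> : qs = s * fR - fR * t by rewrite fR_rel addrC addKr.
have -> : qp = fL * p - t * fL by rewrite fL_rel addrC addKr.
by rewrite mulrBl !mulrBr opprB expr2 !mulrA [in RHS]addrA addrAC.
Qed.

(** With c = s' + s and n = s' s, the product of L by p ^ 2 - c p + n is
    (L p - s L) p - s' (L p - s L), and L p - s L is known from L_rel. *)
Lemma ring_resolvent s' c n : GRing.comm L c -> GRing.comm L n ->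
  s' + s = c -> s' * s = n ->
  L * (p ^+ 2 - c * p + n) = (fR - fL) * p - s' * (fR - fL).
Proof.
move=> Lc Ln cE nE.
have -> : fR - fL = L * p - s * L.
  by apply/eqP; rewrite subr_eq addrAC eq_sym subr_eq L_rel.
rewrite (mulrDr L) (mulrBr L) Ln (mulrA L c) Lc -nE -cE expr2.
rewrite (mulrDl s' s) (mulrDl _ _ p) (mulrBl p) (mulrBr s') !(mulrA _ _ p).
rewrite !(mulrA s') opprB opprD (addrC (- (s' * L * p))) addrA.
by rewrite [RHS]addrA [RHS]addrAC.
Qed.

End RingResolvent.

(** * Paravectors *)

Section Paravector.
Variable R : realType.
Implicit Types (x : 'rV[R]_3) (p s : 'rV[R]_4).

Lemma cl_gen_sqr (j : 'I_3) : cl_gen R j * cl_gen R j = -1.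
Proof.
have := cl_gen_anticomm R j j; rewrite eqxx mulr1 -mulr2n -scaler_nat scaleNr.
by rewrite -scalerN => /scalerI; apply; rewrite pnatr_eq0.
Qed.

Lemma cl_gen_anti (i j : 'I_3) : i != j ->
  cl_gen R i * cl_gen R j = - (cl_gen R j * cl_gen R i).
Proof.
move=> /negbTE ij; apply/eqP; rewrite -addr_eq0.
by rewrite cl_gen_anticomm ij mulr0 scale0r.
Qed.

Lemma vecC_is_linear : linear (@vecC R).
Proof.
move=> a x y; rewrite /vecC scaler_sumr -big_split; apply: eq_bigr => j _.
by rewrite !mxE scalerDl scalerA.
Qed.

HB.instance Definition _ := GRing.isLinear.Build R 'rV[R]_3 (clifford3 R) _
  (@vecC R) vecC_is_linear.

Lemma vecCZ a x : vecC (a *: x) = a *: vecC x.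
Proof. exact: linearZ. Qed.

Lemma vecC_sqr x : vecC x ^+ 2 = - (\sum_(j < 3) x 0 j ^+ 2)%:A.
Proof.
rewrite sqr_sum_anticomm => [|i j ij].
  rewrite scaler_suml -sumrN; apply: eq_bigr => j _.
  by rewrite expr2 -scalerAl -scalerAr cl_gen_sqr scalerA -expr2 scalerN.
rewrite -!(scalerAl, scalerAr) cl_gen_anti // !scalerN !scalerA.
by rewrite [_ * x 0 i]mulrC.
Qed.

Lemma sum_sqr_eq0 x : \sum_(j < 3) x 0 j ^+ 2 = 0 -> x = 0.
Proof.
move=> x0; apply/rowP => j; rewrite mxE; apply/eqP; rewrite -sqrf_eq0.
by apply/eqP; apply: (psumr_eq0P _ x0) => // i _; exact: sqr_ge0.
Qed.

Lemma normsqE s : normsq s = sc s ^+ 2 + \sum_(j < 3) vec s 0 j ^+ 2.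
Proof.
rewrite /normsq big_ord_recl; congr (_ + _).
by apply: eq_bigr => j _; rewrite mxE.
Qed.

Lemma pconj_add s : pconj s + para s = (2 * sc s)%:A.
Proof.
by rewrite addrC /para /pconj addrACA subrr addr0 -scalerDl mulr2n mulrDl mul1r.
Qed.

Lemma pconj_mul s : pconj s * para s = (normsq s)%:A.
Proof.
rewrite /para -{1}[vecC _]opprK sqrB_scalar sqrrN vecC_sqr opprK normsqE.
by rewrite scalerDl.
Qed.

(** The quadratic equation p ^ 2 = 2 p_0 p - |p| ^ 2 lowers the degree, so that
    the polynomial takes a paravector value at p. *)
Lemma para_poly p s : para p ^+ 2 - (2 * sc s) *: para p + (normsq s)%:A =
  ((sc p - sc s) ^+ 2 + (\sum_(j < 3) vec s 0 j ^+ 2)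
    - \sum_(j < 3) vec p 0 j ^+ 2)%:A + vecC ((2 * (sc p - sc s)) *: vec p).
Proof.
have pp : para p ^+ 2 = (2 * sc p) *: para p - (normsq p)%:A.
  by rewrite -pconj_mul -mulr_algl -pconj_add mulrDl addrAC subrr add0r expr2.
rewrite pp !normsqE vecCZ /para.
set wp := \sum_(j < 3) vec p 0 j ^+ 2; set ws := \sum_(j < 3) _.
have -> : (sc p - sc s) ^+ 2 + ws - wp = 2 * sc p * sc p - (sc p ^+ 2 + wp)
    - 2 * sc s * sc p + (sc s ^+ 2 + ws) by ring.
rewrite !scalerDr !scalerA mulrBr scalerBl [in RHS]scalerDl !scalerBl.
rewrite (addrAC _ _ (- (sc p ^+ 2 + wp)%:A)).
by rewrite [- (_ + (2 * sc s) *: _)]opprD addrACA [LHS]addrAC.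
Qed.

(** The inverse of a paravector is its conjugate divided by its squared norm. *)
Lemma scalar_vecC_invertible (a : R) x :
  (a != 0) || (x != 0) -> invertible (a%:A + vecC x : clifford3 R).
Proof.
move=> ax; set N := a ^+ 2 + \sum_(j < 3) x 0 j ^+ 2.
have N0 : N != 0.
  have x2 : 0 <= \sum_(j < 3) x 0 j ^+ 2.
    by apply: sumr_ge0 => j _; exact: sqr_ge0.
  apply: contraL ax; rewrite negb_or !negbK paddr_eq0 ?sqr_ge0 //.
  by rewrite sqrf_eq0 => /andP[-> /eqP/sum_sqr_eq0 ->] /=.
have E y : - y ^+ 2 = (\sum_(j < 3) x 0 j ^+ 2)%:A ->
    (a%:A + y) * (a%:A - y) = N%:A :> clifford3 R.
  by rewrite sqrB_scalar => ->; rewrite -scalerDl.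
exists (N^-1 *: (a%:A - vecC x)); split.
  rewrite -scalerAl -{2}[vecC x]opprK E ?scalerA ?mulVf ?scale1r //.
  by rewrite sqrrN vecC_sqr opprK.
by rewrite -scalerAr E ?scalerA ?mulVf ?scale1r // vecC_sqr opprK.
Qed.

Lemma sphere_classP p s : sc p = sc s ->
  \sum_(j < 3) vec p 0 j ^+ 2 = \sum_(j < 3) vec s 0 j ^+ 2 ->
  sphere_class s (para p).
Proof.
move=> p0 wE; rewrite /sphere_class /para p0.
have [v0|v0] := eqVneq (vec p) 0.
  (* A real p lies on its own sphere for every direction; e_1 is one of them. *)
  exists (cl_gen R 0).
    exists (delta_mx 0 0) => /=.
      rewrite (bigD1 0) //= big1 ?mxE ?addr0 ?expr1n // => j j0.
      by rewrite mxE (negbTE j0) expr0n.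
    rewrite /vecC (bigD1 0) //= big1 ?mxE ?addr0 ?scale1r // => j j0.
    by rewrite mxE (negbTE j0) scale0r.
  rewrite /vnorm -wE v0 big1 ?sqrtr0 ?scale0r ?linear0 // => j _.
  by rewrite mxE expr0n.
have n0 : vnorm (vec p) != 0.
  rewrite sqrtr_eq0 -ltNge lt0r sumr_ge0 ?andbT => [|j _]; last exact: sqr_ge0.
  by apply: contra v0 => /eqP/sum_sqr_eq0 ->.
exists (vecC ((vnorm (vec p))^-1 *: vec p)); last first.
  by rewrite /vnorm -wE vecCZ scalerA mulfV ?scale1r.
exists ((vnorm (vec p))^-1 *: vec p) => //=.
have -> : \sum_(j < 3) ((vnorm (vec p))^-1 *: vec p) 0 j ^+ 2 =
    (vnorm (vec p)) ^- 2 * \sum_(j < 3) vec p 0 j ^+ 2.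
  by rewrite mulr_sumr; apply: eq_bigr => j _; rewrite mxE exprMn exprVn.
rewrite -[X in _ * X]sqr_sqrtr ?sumr_ge0 // => [|j _]; last exact: sqr_ge0.
by rewrite mulVf // sqrf_eq0.
Qed.

(** If both parts of the paravector of para_poly vanish, then p_0 = s_0 or the
    vector part of p is 0.  In the second case the real part
    (p_0 - s_0) ^ 2 + (sum of the s_j ^ 2) is a sum of squares, so p_0 = s_0
    and the vector part of s is 0 too. *)
Lemma para_poly_invertible p s : ~ sphere_class s (para p) ->
  invertible (para p ^+ 2 - (2 * sc s) *: para p + (normsq s)%:A).
Proof.
move=> ps; rewrite para_poly; apply: scalar_vecC_invertible.
apply/negP => /negP; rewrite negb_or !negbK scaler_eq0 mulf_eq0 pnatr_eq0 /=.
have ws0 : 0 <= \sum_(j < 3) vec s 0 j ^+ 2.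
  by rewrite sumr_ge0 // => j _; exact: sqr_ge0.
move=> /andP[/eqP a0 /orP[p0|/eqP v0]]; apply: ps; apply: sphere_classP.
- by apply/eqP; rewrite -subr_eq0.
- by move: a0; rewrite (eqP p0) expr0n add0r => /eqP; rewrite subr_eq0 => /eqP.
- have := sqr_ge0 (sc p - sc s); have := a0.
  rewrite v0 [X in _ - X]big1 => [|j _]; last by rewrite mxE expr0n.
  by move=> ? ?; apply/eqP; rewrite -subr_eq0 -sqrf_eq0; apply/eqP; lra.
- have := sqr_ge0 (sc p - sc s); have := a0.
  rewrite v0 [X in _ - X]big1 => [|j _]; last by rewrite mxE expr0n.
  move=> ? ?; rewrite [LHS]big1 => [|j _]; last by rewrite mxE expr0n.
  by lra.
Qed.

End Paravector.

(** * The operators T and their conjugates *)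

Section Operators.
Variables (R : realType) (V : normedModType R).
Implicit Types (T : BC01 V) (x : clifford3 R) (s : 'rV[R]_4).

HB.instance Definition _ := GRing.isLinear.Build R (clifford3 R) (op3 V) _
  (@lmul R V) (@lmulP R V).

(** The scalars x_A of x pass through the linear map f, which acts on each
    coefficient separately. *)
Lemma comm_lmul_const (f : V -> V) (bf : bounded_linear f) x :
  GRing.comm (lmul V x) (op3_const bf).
Proof.
apply/val_inj/funext => v; apply/ffunP => C /=.
have lf := bf.1; rewrite -[RHS]/(op3_const bf (lmul V x v) C).
rewrite -[LHS]/(lmul V x (op3_const bf v) C) op3_constE !op3_ofE.
rewrite (linear_sumZ _ _ lf); apply: eq_bigr => A _; congr (_ *: _).
rewrite op3_constE /lmul_coef !fctE.
(* Homogeneity of f, as a sum with one term. *)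
have := linear_sumZ (fun=> x A) (fun=> v (symd A C)) lf (I := 'I_1).
by rewrite !big_ord1 => ->.
Qed.

Lemma comm_lmul_comp x T i : GRing.comm (lmul V x) (bc_comp T i).
Proof. exact: comm_lmul_const. Qed.

Lemma comm_comp T i j : GRing.comm (bc_comp T i) (bc_comp T j).
Proof.
apply/val_inj/funext => v; apply/ffunP => C.
rewrite -[LHS]/(bc_comp T i (bc_comp T j v) C).
rewrite -[RHS]/(bc_comp T j (bc_comp T i v) C) !op3_constE.
exact: (congr1 (fun f => f (v C)) (bc_comm T i j)).
Qed.

Lemma comm_comp_vec T i : GRing.comm (bc_comp T i) (bc_vec T).
Proof.
apply: commr_sum => j _; apply: commrM; last exact: comm_comp.
exact/commr_sym/comm_lmul_comp.
Qed.

Lemma bc_vec_sqr T : bc_vec T ^+ 2 = - \sum_(j < 3) bc_comp T (lift 0 j) ^+ 2.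
Proof.
have E i j : lmul V (cl_gen R i) * bc_comp T (lift 0 i) *
    (lmul V (cl_gen R j) * bc_comp T (lift 0 j)) =
    lmul V (cl_gen R i * cl_gen R j) *
    (bc_comp T (lift 0 i) * bc_comp T (lift 0 j)).
  rewrite lmulM -!mulrA; congr (_ * _); rewrite !mulrA; congr (_ * _).
  exact/esym/comm_lmul_comp.
rewrite sqr_sum_anticomm => [|i j ij].
  rewrite -sumrN; apply: eq_bigr => j _.
  by rewrite expr2 E cl_gen_sqr linearN /= lmul1 mulN1r.
by rewrite !E cl_gen_anti // linearN /= mulNr comm_comp.
Qed.

(** Together with bc_norm: T + T' and T T' are built from the real components
    T_i alone, hence they commute with Clifford multiplications. *)
Lemma bc_trace T : bc_op T + bc_conj T = bc_comp T 0 + bc_comp T 0.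
Proof. by rewrite /bc_op /bc_conj addrACA subrr addr0. Qed.

Lemma bc_norm T : bc_op T * bc_conj T = \sum_i bc_comp T i ^+ 2.
Proof.
rewrite big_ord_recl -[X in _ + X]opprK -bc_vec_sqr /bc_op /bc_conj.
by rewrite mulrDl !mulrBr comm_comp_vec addrA subrK.
Qed.

Lemma comm_bc_op_conj T : GRing.comm (bc_op T) (bc_conj T).
Proof.
have cv := comm_comp_vec T 0.
apply: commrB; apply/commr_sym; apply: commrD => //; exact/commr_sym.
Qed.

Lemma comm_lmul_trace T x : GRing.comm (lmul V x) (bc_op T + bc_conj T).
Proof. by rewrite bc_trace; apply: commrD; exact: comm_lmul_comp. Qed.

Lemma comm_lmul_norm T x : GRing.comm (lmul V x) (bc_op T * bc_conj T).
Proof.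
by rewrite bc_norm; apply: commr_sum => i _; apply: commrX; exact: comm_lmul_comp.
Qed.

Lemma rho_F_Q T s : rho_F T s ->
  Q s T * Qinv s T = 1 /\ Qinv s T * Q s T = 1.
Proof. by move=> /contrapT/inverseP. Qed.

Lemma comm_scalar (a : R) (F : op3 V) : GRing.comm F (a *: (1 : op3 V) : op3 V).
Proof. by rewrite /GRing.comm -op3_scaleAr -op3_scaleAl mulr1 mul1r. Qed.

Lemma lmulZ a x : lmul V (a *: x) = a *: lmul V x.
Proof. exact: linearZ. Qed.

Lemma lmul_scalar (a : R) : lmul V a%:A = a *: (1 : op3 V).
Proof. by rewrite lmulZ lmul1. Qed.

Lemma lmul_pconj_add s :
  lmul V (pconj s) + lmul V (para s) = (2 * sc s) *: (1 : op3 V).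
Proof. by rewrite -lmul_scalar -pconj_add [RHS]linearD. Qed.

Lemma lmul_pconj_mul s :
  lmul V (pconj s) * lmul V (para s) = normsq s *: (1 : op3 V).
Proof. by rewrite -lmulM pconj_mul lmul_scalar. Qed.

End Operators.

Theorem theorem7p2 (R : realType) (V : completeNormedModType R) (T : BC01 V)
    (p s : 'rV[R]_4) (hp : rho_F T p) (hs : rho_F T s)
    (hps : ~ sphere_class s (para p)) :
  F3R s T * SCL p T + SCR s T * F3L p T
  + (gamma3 R)^-1 *:
    (lmul V (para s) * F3R s T * F3L p T * lmul V (para p)
     - lmul V (para s) * F3R s T * bc_op T * F3L p T
     - F3R s T * bc_op T * F3L p T * lmul V (para p)
     + F3R s T * bc_op T ^+ 2 * F3L p T)
  = ((F3R s T - F3L p T) * lmul V (para p)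
     - lmul V (pconj s) * (F3R s T - F3L p T))
    * lmul V (inverse
        (para p ^+ 2 - (2 * sc s) *: para p + (normsq s)%:A)).
Proof.
have [QsP PsQ] := rho_F_Q _ _ _ _ hs; have [QpP PpQ] := rho_F_Q _ _ _ _ hp.
have tt' := comm_bc_op_conj _ _ T.
have str := comm_lmul_trace _ _ T (para s).
have ptr := comm_lmul_trace _ _ T (para p).
have snm := comm_lmul_norm _ _ T (para s).
have pnm := comm_lmul_norm _ _ T (para p).
have [_ DDinv] := inverseP _ _ (para_poly_invertible _ _ _ hps).
have g0 : gamma3 R != 0 by rewrite oppr_eq0 pnatr_eq0.
have bracket := bracket_factor _ _ _ _ _ _ _ tt' str ptr snm pnm QsP PsQ QpP PpQ.
have res := ring_resolvent _ _ _ _ _ _ _ tt' str ptr snm pnm QsP PsQ QpP PpQ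
  _ _ _ (comm_scalar _ _ _ _) (comm_scalar _ _ _ _)
  (lmul_pconj_add _ _ s) (lmul_pconj_mul _ _ s).
rewrite /F3R /F3L /SCL /SCR.
set X := Q s T ^+ 2 * _ in bracket res *; set Y := _ * Q p T ^+ 2 in bracket res *.
rewrite -!(op3_scaleAl, op3_scaleAr) -!(scalerBr, scalerDr).
rewrite (scalerA _^-1) mulVf // scale1r bracket -!(op3_scaleAl, op3_scaleAr).
rewrite -!(scalerBr, scalerDr) -op3_scaleAl; congr (_ *: _).
set D := (X in inverse X) in DDinv *.
have DE : lmul V D = lmul V (para p) ^+ 2
    - ((2 * sc s) *: (1 : op3 V)) * lmul V (para p) + normsq s *: (1 : op3 V).
  rewrite /D linearD linearB /= lmulZ lmul_scalar !expr2 lmulM.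
  by rewrite -op3_scaleAl mul1r.
by rewrite -res -DE -(mulrA _ (lmul V D)) -lmulM DDinv lmul1 mulr1.
Qed.
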